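(* A Whitney's cusp is realized by a Helmholtz wave. In fact, the function $$\psi(x,y)=x^3\cos y+(x-3xy)\sin y+\mathrm{i}\sin y$$ is a Whitney's cusp at the origin and satisfies the Helmholtz equation ($k=1$) $\psi_{xx}+\psi_{yy}+\psi=0$. Moreover, $$\Psi(x,y,t)=\bigl(x^3\cos y+(x-3xy)\sin y+\mathrm{i}\sin y\bigr)\cos t+\mathrm{i}\cos y\,\sin t$$ is a deformation of $\psi=\Psi(\cdot,\cdot,0)$ by a Helmholtz wave ($k=1$, $c=1$) describing a three point bifurcation of the phase singularity: near the origin, as $t$ passes through $0$, the number of zeros of $\Psi(\cdot,\cdot,t)$ changes between one and three, the single degenerate zero at $t=0$ bifurcating into three zeros on one side of $t=0$.
   Context: A Helmholtz wave for $k,c>0$ is a smooth complex valued function $\Psi(x,y,t)$ satisfying both the Helmholtz equation $\Psi_{xx}+\Psi_{yy}+k^2\Psi=0$ and the wave equation $\Psi_{tt}=c^2(\Psi_{xx}+\Psi_{yy})$. A smooth map germ $\psi:(\mathbb{R}^2,(x_0,y_0))\to(\mathbb{C},0)$ is called a Whitney's cusp if it is right-left equivalent (under arbitrary local diffeomorphisms of $\mathbb{R}^2$ and $\mathbb{C}\cong\mathbb{R}^2$) to the germ at the origin of $(x,y)\mapsto x^3+xy+\mathrm{i}y$. *)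

(* Defs.v *)
From Stdlib Require Import Reals List.
From Coquelicot Require Import Coquelicot.
Open Scope R_scope.

(* f is C^n on the open set U: f' p is the (Frechet) differential of f at p,
   and p |-> f' p v is required to be C^(n-1) for each direction v, which in
   finite dimension says that the differential is itself C^(n-1). *)
Fixpoint Ck_on {V W : NormedModule R_AbsRing} (n : nat)
    (U : V -> Prop) (f : V -> W) : Prop :=
  match n with
  | O => forall p, U p -> continuous f p
  | S m => exists f' : V -> V -> W,
      (forall p, U p -> filterdiff f (locally p) (f' p)) /\
      (forall v, Ck_on m U (fun p => f' p v))
  end.

Definition smooth_on {V W : NormedModule R_AbsRing}
    (U : V -> Prop) (f : V -> W) : Prop :=
  forall n, Ck_on n U f.

Definition smooth {V W : NormedModule R_AbsRing} (f : V -> W) : Prop :=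
  smooth_on (fun _ => True) f.

Definition smooth_germ {V W : NormedModule R_AbsRing} (f : V -> W) (p : V)
    : Prop :=
  exists U : V -> Prop, open U /\ U p /\ smooth_on U f.

Definition local_diffeo {V W : NormedModule R_AbsRing}
    (f : V -> W) (p : V) (q : W) : Prop :=
  smooth_germ f p /\ f p = q /\
  exists g : W -> V,
    smooth_germ g q /\ g q = p /\
    locally p (fun x => g (f x) = x) /\
    locally q (fun y => f (g y) = y).

(* The germs f1 : (V1, p1) -> (W1, q1) and f2 : (V2, p2) -> (W2, q2) satisfy
   Phi o f1 = f2 o phi for some germs of diffeomorphisms phi and Phi. *)
Definition right_left_equivalent {V1 W1 V2 W2 : NormedModule R_AbsRing}
    (f1 : V1 -> W1) (p1 : V1) (q1 : W1)
    (f2 : V2 -> W2) (p2 : V2) (q2 : W2) : Prop :=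
  exists (phi : V1 -> V2) (Phi : W1 -> W2),
    local_diffeo phi p1 p2 /\ local_diffeo Phi q1 q2 /\
    locally p1 (fun x => Phi (f1 x) = f2 (phi x)).

(* C is used as a real normed space, not as a module over itself. *)
Definition plane_map (f : R -> R -> C) : R * R -> C_R_NormedModule :=
  fun p => f (fst p) (snd p).

Definition spacetime_map (F : R -> R -> R -> C)
    : R * R * R -> C_R_NormedModule :=
  fun p => F (fst (fst p)) (snd (fst p)) (snd p).

Definition whitney_normal_form (x y : R) : C :=
  (RtoC (x ^ 3 + x * y) + Ci * RtoC y)%C.

Definition whitney_cusp (f : R -> R -> C) (x0 y0 : R) : Prop :=
  smooth_germ (plane_map f) (x0, y0) /\
  f x0 y0 = RtoC 0 /\
  right_left_equivalent
    (plane_map f) (x0, y0) (RtoC 0)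
    (plane_map whitney_normal_form) (0, 0) (RtoC 0).

(* Derivative of a complex valued function of a real variable. *)
Definition CDerive (f : R -> C) (s : R) : C :=
  (Derive (fun u => Re (f u)) s, Derive (fun u => Im (f u)) s).

Definition CDerive2 (f : R -> C) (s : R) : C := CDerive (CDerive f) s.

Definition laplacian (f : R -> R -> C) (x y : R) : C :=
  (CDerive2 (fun u => f u y) x + CDerive2 (fun u => f x u) y)%C.

Definition helmholtz_equation (k : R) (f : R -> R -> C) : Prop :=
  forall x y : R,
    (laplacian f x y + RtoC (k ^ 2) * f x y)%C = RtoC 0.

Definition wave_equation (c : R) (F : R -> R -> R -> C) : Prop :=
  forall x y t : R,
    CDerive2 (fun u => F x y u) t =
    (RtoC (c ^ 2) * laplacian (fun u v => F u v t) x y)%C.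

Definition helmholtz_wave (k c : R) (F : R -> R -> R -> C) : Prop :=
  0 < k /\ 0 < c /\
  smooth (spacetime_map F) /\
  (forall t : R, helmholtz_equation k (fun x y => F x y t)) /\
  wave_equation c F.

Definition jacobian (f : R -> R -> C) (x y : R) : R :=
  Derive (fun u => Re (f u y)) x * Derive (fun v => Im (f x v)) y -
  Derive (fun v => Re (f x v)) y * Derive (fun u => Im (f u y)) x.

Definition degenerate_zero (f : R -> R -> C) (x y : R) : Prop :=
  f x y = RtoC 0 /\ jacobian f x y = 0.

Definition number_of_zeros_in (U : R * R -> Prop) (f : R -> R -> C) (n : nat)
    : Prop :=
  exists l : list (R * R),
    NoDup l /\ length l = n /\
    forall p : R * R, In p l <-> (U p /\ f (fst p) (snd p) = RtoC 0).

(* The sign s records on which side of t0 there are three zeros.  Quantifying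
   over all small radii r makes the three zeros emanate from (x0, y0). *)
Definition three_point_bifurcation (F : R -> R -> R -> C) (x0 y0 t0 : R)
    : Prop :=
  degenerate_zero (fun x y => F x y t0) x0 y0 /\
  exists s : R, (s = 1 \/ s = -1) /\
  exists r0 : R, 0 < r0 /\
  forall r : R, 0 < r < r0 ->
    number_of_zeros_in (ball (x0, y0) r) (fun x y => F x y t0) 1 /\
    exists delta : R, 0 < delta /\
    forall tau : R, 0 < tau < delta ->
      number_of_zeros_in (ball (x0, y0) r)
        (fun x y => F x y (t0 - s * tau)) 1 /\
      number_of_zeros_in (ball (x0, y0) r)
        (fun x y => F x y (t0 + s * tau)) 3.

Definition cusp_psi (x y : R) : C :=
  (RtoC (x ^ 3 * cos y + (x - 3 * x * y) * sin y) + Ci * RtoC (sin y))%C.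

Definition cusp_Psi (x y t : R) : C :=
  ((RtoC (x ^ 3 * cos y + (x - 3 * x * y) * sin y) + Ci * RtoC (sin y))
     * RtoC (cos t)
   + Ci * RtoC (cos y) * RtoC (sin t))%C.

(* Main.v *)
Require Import Defs.
From Stdlib Require Import Reals List Lra FunctionalExtensionality.
From Coquelicot Require Import Coquelicot.
Open Scope R_scope.

(** Three facts carry the proof.

    The cusp.  On the strip [|y| < 1/3] put [a(y) = sqrt (cos y / (1 - 3y))],
    so that [a^2 (1 - 3y) = cos y].  Then
    [a^3 x^3 + (a x) sin y = (a / (1 - 3y)) (x^3 cos y + x (1 - 3y) sin y)],
    which says that the map [(x, y) |-> (a(y) x, sin y)] in the source and the
    map [(U, V) |-> (U a(y) / (1 - 3y), V)], with [y = asin V], in the target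
    carry psi to the normal form [(X, Y) |-> (X^3 + X Y, Y)].  Both maps have
    the shape [(x, y) |-> (x a(y), b(y))], and such a map is inverted
    explicitly once [b] is ([local_diffeo_fibred]); no inverse function
    theorem is involved.  [whitney_cusp_cusp_psi] assembles this.

    The wave.  Since [sin y cos t + cos y sin t = sin (y + t)], both components
    of Psi are elementary, and a direct computation gives
    [Psi_xx + Psi_yy = - Psi = Psi_tt], which is both equations for
    [k = c = 1] ([laplacian_cusp_Psi], [CDerive2_cusp_Psi_time]).

    The zeros.  The imaginary part [sin (y + t)] forces [y = -t]; the real part
    then becomes a nonzero multiple of [x (x^2 - (1 + 3t) tan t)]
    ([cusp_Psi_eq_0]).  The bracket is positive for small [t < 0] and [x <> 0],
    is [x^2] for [t = 0], and has two roots [x = +-sqrt ((1 + 3t) tan t)], which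
    tend to [0] with [t], for [t > 0].

    Smoothness of every map above follows from closure of the C^n functions
    under sums, products, pairs, and composition with a function of one real
    variable. *)

(** * Calculus of C^n functions *)

Lemma Ck_on_pred {V W : NormedModule R_AbsRing} (n : nat) (U : V -> Prop) :
  forall f : V -> W, Ck_on (S n) U f -> Ck_on n U f.
Proof.
  induction n as [|n IH]; intros f [f' [Hd Hc]].
  - intros p Hp. apply filterdiff_continuous. exists (f' p). exact (Hd p Hp).
  - exists f'. split; [exact Hd|]. intros v. apply IH, Hc.
Qed.

Lemma Ck_on_const {V W : NormedModule R_AbsRing} (n : nat) (U : V -> Prop) :
  forall a : W, Ck_on n U (fun _ => a).
Proof.
  induction n as [|n IH]; intros a.
  - intros p _. apply continuous_const.
  - exists (fun _ _ => zero). split.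
    + intros p _. apply filterdiff_const.
    + intros _. apply IH.
Qed.

Lemma Ck_on_linear {V W : NormedModule R_AbsRing} (n : nat) (U : V -> Prop)
    (l : V -> W) : is_linear l -> Ck_on n U l.
Proof.
  intros Hl. destruct n as [|n].
  - intros p _. exact (linear_cont l p Hl).
  - exists (fun _ => l). split.
    + intros p _. exact (filterdiff_linear l Hl).
    + intros v. apply Ck_on_const.
Qed.

Lemma Ck_on_plus {V : NormedModule R_AbsRing} (n : nat) (U : V -> Prop) :
  forall f g : V -> R_NormedModule,
    Ck_on n U f -> Ck_on n U g -> Ck_on n U (fun p => f p + g p).
Proof.
  induction n as [|n IH]; intros f g Hf Hg.
  - intros p Hp. exact (continuous_plus f g p (Hf p Hp) (Hg p Hp)).
  - destruct Hf as [f' [Hfd Hfc]], Hg as [g' [Hgd Hgc]].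
    exists (fun p v => f' p v + g' p v). split.
    + intros p Hp.
      exact (filterdiff_plus_fct f g (f' p) (g' p) (Hfd p Hp) (Hgd p Hp)).
    + intros v. apply (IH _ _ (Hfc v) (Hgc v)).
Qed.

Lemma Ck_on_mult {V : NormedModule R_AbsRing} (n : nat) (U : V -> Prop) :
  forall f g : V -> R_NormedModule,
    Ck_on n U f -> Ck_on n U g -> Ck_on n U (fun p => f p * g p).
Proof.
  induction n as [|n IH]; intros f g Hf Hg.
  - intros p Hp.
    exact (continuous_mult (K := R_AbsRing) f g p (Hf p Hp) (Hg p Hp)).
  - pose proof (Ck_on_pred n U f Hf) as Hf0.
    pose proof (Ck_on_pred n U g Hg) as Hg0.
    destruct Hf as [f' [Hfd Hfc]], Hg as [g' [Hgd Hgc]].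
    exists (fun p v => f' p v * g p + f p * g' p v). split.
    + intros p Hp.
      exact (filterdiff_mult_fct f g p (f' p) (g' p) Rmult_comm
               (Hfd p Hp) (Hgd p Hp)).
    + intros v. apply Ck_on_plus; apply IH; auto.
Qed.

(** The outer function is restricted to one real variable because the
    differential [v |-> g'(f p) (f' p v)] is then the product of [f' p v] by the
    scalar [g'(f p) 1], so that the induction goes through [Ck_on_mult].  For a
    vector valued [f] the direction [f' p v], which moves with [p], could not be
    traded for a fixed one in this way. *)
Lemma Ck_on_comp {V : NormedModule R_AbsRing} (n : nat)
    (U : V -> Prop) (T : R -> Prop) :
  forall (f : V -> R_NormedModule) (g : R_NormedModule -> R_NormedModule),
    (forall p, U p -> T (f p)) ->
    Ck_on n U f -> Ck_on n T g -> Ck_on n U (fun p => g (f p)).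
Proof.
  induction n as [|n IH]; intros f g HUT Hf Hg.
  - intros p Hp. apply continuous_comp; auto.
  - pose proof (Ck_on_pred n U f Hf) as Hf0.
    destruct Hf as [f' [Hfd Hfc]], Hg as [g' [Hgd Hgc]].
    exists (fun p v => f' p v * g' (f p) 1). split.
    + intros p Hp.
      pose proof (Hgd (f p) (HUT p Hp)) as Hg1.
      apply (filterdiff_ext_lin _ (fun v => g' (f p) (f' p v))).
      * exact (filterdiff_comp' f g p (f' p) (g' (f p)) (Hfd p Hp) Hg1).
      * intros v. destruct Hg1 as [Hlin _].
        transitivity (g' (f p) (scal (f' p v) 1)).
        -- f_equal. exact (eq_sym (Rmult_1_r (f' p v))).
        -- exact (linear_scal _ Hlin (f' p v) 1).
    + intros v. apply Ck_on_mult; [apply Hfc|].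
      apply (IH f (fun x => g' x 1) HUT Hf0 (Hgc 1)).
Qed.

Lemma Ck_on_pair {V W1 W2 : NormedModule R_AbsRing} (n : nat) (U : V -> Prop) :
  forall (f : V -> W1) (g : V -> W2),
    Ck_on n U f -> Ck_on n U g ->
    Ck_on (W := prod_NormedModule R_AbsRing W1 W2) n U (fun p => (f p, g p)).
Proof.
  induction n as [|n IH]; intros f g Hf Hg.
  - intros p Hp.
    apply (continuous_comp_2 f g (fun a b => (a, b)));
      [exact (Hf p Hp)|exact (Hg p Hp)|].
    apply (continuous_ext (fun q => q)); [now intros []|apply continuous_id].
  - destruct Hf as [f' [Hfd Hfc]], Hg as [g' [Hgd Hgc]].
    exists (fun p v => (f' p v, g' p v)). split.
    + intros p Hp.
      apply (filterdiff_comp'_2 (W := prod_NormedModule R_AbsRing W1 W2)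
               f g (fun a b => (a, b)) p (f' p) (g' p) (fun a b => (a, b))
               (Hfd p Hp) (Hgd p Hp)).
      apply filterdiff_linear.
      apply is_linear_prod; [apply is_linear_fst|apply is_linear_snd].
    + intros v. apply (IH _ _ (Hfc v) (Hgc v)).
Qed.

Lemma Ck_on_is_derive (n : nat) (T : R -> Prop)
    (g g1 : R_NormedModule -> R_NormedModule) :
  (forall x, T x -> is_derive g x (g1 x)) -> Ck_on n T g1 -> Ck_on (S n) T g.
Proof.
  intros Hd Hc. exists (fun x v => v * g1 x). split.
  - exact Hd.
  - intros v. apply Ck_on_mult; [apply Ck_on_const|exact Hc].
Qed.

(** Bootstrap: when [g'] is a smooth expression in [g], C^n regularity of [g]
    passes to [g'], which is C^(n+1) regularity of [g].  This suits [/ x] and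
    [sqrt], whose derivatives are [- (/ x)^2] and [/ (2 sqrt x)]. *)
Lemma smooth_on_is_derive_rec (T : R -> Prop)
    (g g1 : R_NormedModule -> R_NormedModule) :
  (forall x, T x -> is_derive g x (g1 x)) ->
  (forall n, Ck_on n T g -> Ck_on n T g1) -> smooth_on T g.
Proof.
  intros Hd Hstep n. induction n as [|n IH].
  - intros x Hx. apply filterdiff_continuous. eexists. exact (Hd x Hx).
  - exact (Ck_on_is_derive n T g g1 Hd (Hstep n IH)).
Qed.

Lemma Ck_on_sin_cos (n : nat) (T : R -> Prop) :
  Ck_on (V := R_NormedModule) (W := R_NormedModule) n T sin /\
  Ck_on (V := R_NormedModule) (W := R_NormedModule) n T cos.
Proof.
  induction n as [|n [IHs IHc]].
  - split; intros x _.
    + apply continuous_sin.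
    + apply continuous_cos.
  - split.
    + apply (Ck_on_is_derive n T sin cos); [|exact IHc].
      intros x _. apply is_derive_sin.
    + apply (Ck_on_is_derive n T cos (fun x => -1 * sin x)).
      * intros x _. auto_derive; [exact I|ring].
      * apply Ck_on_mult; [apply Ck_on_const|exact IHs].
Qed.

Lemma smooth_on_Rinv (T : R -> Prop) :
  (forall x, T x -> x <> 0) ->
  smooth_on (V := R_NormedModule) (W := R_NormedModule) T Rinv.
Proof.
  intros HT. apply (smooth_on_is_derive_rec T Rinv (fun x => -1 * (/ x * / x))).
  - intros x Hx. auto_derive; [exact (HT x Hx)|]. field. exact (HT x Hx).
  - intros n Hn. apply Ck_on_mult; [apply Ck_on_const|].
    apply Ck_on_mult; exact Hn.
Qed.

Lemma smooth_on_sqrt :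
  smooth_on (V := R_NormedModule) (W := R_NormedModule) (fun x => 0 < x) sqrt.
Proof.
  apply (smooth_on_is_derive_rec _ sqrt (fun x => / 2 * / sqrt x)).
  - intros x Hx. auto_derive; [exact Hx|].
    field. apply Rgt_not_eq, sqrt_lt_R0, Hx.
  - intros n Hn. apply Ck_on_mult; [apply Ck_on_const|].
    apply (Ck_on_comp n _ (fun x => 0 < x) sqrt Rinv).
    + intros x Hx. apply sqrt_lt_R0, Hx.
    + exact Hn.
    + apply smooth_on_Rinv. intros x Hx. lra.
Qed.

Lemma smooth_on_asin :
  smooth_on (V := R_NormedModule) (W := R_NormedModule)
    (fun x => -1 < x < 1) asin.
Proof.
  apply (smooth_on_is_derive_rec _ asin (fun x => / sqrt (1 + -1 * (x * x)))).
  - intros x Hx. apply is_derive_Reals.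
    replace (/ sqrt (1 + -1 * (x * x))) with (1 / sqrt (1 - x²)).
    + rewrite <- (derive_pt_asin x Hx).
      apply (derive_pt_eq_1 _ _ _ (derivable_pt_asin x Hx)). reflexivity.
    + unfold Rdiv, Rsqr. rewrite Rmult_1_l. do 2 f_equal. ring.
  - intros n _.
    apply (Ck_on_comp n _ (fun x => 0 < x) (fun x => sqrt (1 + -1 * (x * x))) Rinv).
    + intros x Hx. apply sqrt_lt_R0. nra.
    + apply (Ck_on_comp n _ (fun x => 0 < x) (fun x => 1 + -1 * (x * x)) sqrt).
      * intros x Hx. nra.
      * apply Ck_on_plus; [apply Ck_on_const|].
        apply Ck_on_mult; [apply Ck_on_const|].
        apply Ck_on_mult; apply Ck_on_linear, is_linear_id.
      * apply smooth_on_sqrt.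
    + apply smooth_on_Rinv. intros x Hx. lra.
Qed.

(* The factors are passed explicitly: left to unification, [fun p => c * p]
   would be split into eta-reduced pieces that no pattern here recognizes. *)
Ltac prove_Ck_on :=
  repeat match goal with
  | |- Ck_on ?n ?U (fun p => @?f p + @?g p) => apply (Ck_on_plus n U f g)
  | |- Ck_on ?n ?U (fun p => @?f p * @?g p) => apply (Ck_on_mult n U f g)
  | |- Ck_on ?n ?U (fun p => sin (@?f p)) =>
      apply (Ck_on_comp n U (fun _ => True) f sin (fun _ _ => I));
      [|apply Ck_on_sin_cos]
  | |- Ck_on ?n ?U (fun p => cos (@?f p)) =>
      apply (Ck_on_comp n U (fun _ => True) f cos (fun _ _ => I));
      [|apply Ck_on_sin_cos]
  | |- Ck_on _ _ (fun _ => ?c) => apply Ck_on_const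
  | |- Ck_on _ _ (fun p => p) => apply Ck_on_linear, is_linear_id
  | |- Ck_on _ _ (fun p => fst p) => apply Ck_on_linear, is_linear_fst
  | |- Ck_on _ _ (fun p => snd p) => apply Ck_on_linear, is_linear_snd
  | |- Ck_on _ _ (fun p => fst (fst p)) =>
      apply Ck_on_linear, (is_linear_comp fst fst); apply is_linear_fst
  | |- Ck_on _ _ (fun p => snd (fst p)) =>
      apply Ck_on_linear, (is_linear_comp fst snd);
      [apply is_linear_fst|apply is_linear_snd]
  end.

(** * Diffeomorphisms that map horizontal lines to horizontal lines *)

Lemma Ck_on_comp_snd (n : nat) (T : R -> Prop)
    (a : R_NormedModule -> R_NormedModule) :
  Ck_on n T a ->
  Ck_on (V := prod_NormedModule R_AbsRing R_NormedModule R_NormedModule)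
    n (fun p => T (snd p)) (fun p => a (snd p)).
Proof.
  intros Ha.
  apply (Ck_on_comp n _ T (fun p => snd p) a); [tauto| |exact Ha].
  apply Ck_on_linear, is_linear_snd.
Qed.

Lemma open_snd (T : R -> Prop) : open T -> open (fun p : R * R => T (snd p)).
Proof.
  intros HT. apply (open_comp (fun p : R * R => snd p) T); [|exact HT].
  intros p _. apply continuous_snd.
Qed.

Lemma locally_snd (T : R -> Prop) (P : R * R -> Prop) :
  open T -> T 0 -> (forall x y, T y -> P (x, y)) ->
  locally ((0, 0) : R * R) P.
Proof.
  intros HT HT0 HP. apply (filter_imp (fun p : R * R => T (snd p))).
  - intros [x y] Hy. exact (HP x y Hy).
  - exact (open_snd T HT (0, 0) HT0).
Qed.

(** The inverse is [(X, Y) |-> (X / a(binv Y), binv Y)], smooth because [a] does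
    not vanish and [binv] is smooth. *)
Lemma local_diffeo_fibred (T S : R -> Prop)
    (a b binv : R_NormedModule -> R_NormedModule) :
  open T -> T 0 -> open S -> S 0 ->
  smooth_on T a -> (forall y, T y -> a y <> 0) ->
  smooth_on T b -> smooth_on S binv ->
  (forall z, S z -> T (binv z)) ->
  (forall y, T y -> binv (b y) = y) ->
  (forall z, S z -> b (binv z) = z) ->
  b 0 = 0 ->
  local_diffeo
    (V := prod_NormedModule R_AbsRing R_NormedModule R_NormedModule)
    (W := prod_NormedModule R_AbsRing R_NormedModule R_NormedModule)
    (fun p => (fst p * a (snd p), b (snd p))) (0, 0) (0, 0).
Proof.
  intros HT HT0 HS HS0 Ha Ha0 Hb Hbinv HST Hbl Hbr Hb0.
  assert (Hbinv0 : binv 0 = 0) by (rewrite <- Hb0 at 1; apply Hbl, HT0).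
  split; [|split].
  - exists (fun p => T (snd p)). split; [apply open_snd, HT|split; [exact HT0|]].
    intros n. apply Ck_on_pair.
    + apply Ck_on_mult; [apply Ck_on_linear, is_linear_fst|].
      apply Ck_on_comp_snd, Ha.
    + apply Ck_on_comp_snd, Hb.
  - simpl. rewrite Hb0. f_equal. ring.
  - exists (fun q => (fst q * / a (binv (snd q)), binv (snd q))).
    split; [|split; [|split]].
    + exists (fun q => S (snd q)).
      split; [apply open_snd, HS|split; [exact HS0|]].
      intros n. apply Ck_on_pair.
      * apply Ck_on_mult; [apply Ck_on_linear, is_linear_fst|].
        apply (Ck_on_comp_snd n S (fun z => / a (binv z))).
        apply (Ck_on_comp n S (fun w => w <> 0) (fun z => a (binv z)) Rinv).
        -- intros z Hz. apply Ha0, HST, Hz.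
        -- apply (Ck_on_comp n S T binv a HST (Hbinv n) (Ha n)).
        -- apply smooth_on_Rinv. tauto.
      * apply Ck_on_comp_snd, Hbinv.
    + simpl. rewrite Hbinv0. f_equal. ring.
    + refine (locally_snd T _ HT HT0 _). intros x y Hy; simpl. rewrite (Hbl y Hy). f_equal.
      rewrite Rmult_assoc, Rinv_r, Rmult_1_r; [reflexivity|apply Ha0, Hy].
    + refine (locally_snd S _ HS HS0 _). intros x z Hz; simpl. rewrite (Hbr z Hz). f_equal.
      rewrite Rmult_assoc, Rinv_l, Rmult_1_r; [reflexivity|apply Ha0, HST, Hz].
Qed.

(** * The normal form of the cusp *)

Definition interval (r x : R) : Prop := - r < x < r.

Lemma open_interval (r : R) : open (interval r).
Proof. apply (open_and (fun x => - r < x) (fun x => x < r)); [apply open_gt|apply open_lt]. Qed.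

Lemma cos_ge_half (y : R) : interval 1 y -> / 2 <= cos y.
Proof.
  intros Hy. unfold interval in Hy. pose proof PI2_3_2 as HPI.
  assert (Hpos : forall z, 0 <= z <= 1 -> / 2 <= cos z).
  { intros z Hz. replace (/ 2) with (cos (PI / 3)) by (rewrite cos_PI3; lra).
    apply cos_decr_1; lra. }
  destruct (Rle_lt_dec 0 y).
  - apply Hpos; lra.
  - rewrite <- cos_neg. apply Hpos; lra.
Qed.

Lemma sin_ge_half_id (y : R) : 0 <= y < 1 -> y / 2 <= sin y.
Proof.
  intros Hy. destruct (Req_dec y 0) as [->|Hy0]; [rewrite sin_0; lra|].
  destruct (MVT_cor2 sin cos 0 y) as [c [Hc Hcy]].
  - lra.
  - intros c _. apply derivable_pt_lim_sin.
  - rewrite sin_0 in Hc. pose proof (cos_ge_half c). unfold interval in H.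
    assert (/ 2 <= cos c) by (apply H; lra). nra.
Qed.

(** The radii [1/6] and [1/3] match because [1/6 <= sin (1/3)], and
    [1 - 3y] stays positive on the larger interval. *)
Lemma asin_interval (v : R) : interval (/ 6) v -> interval (/ 3) (asin v).
Proof.
  unfold interval. intros Hv. pose proof PI2_3_2.
  pose proof (asin_bound_lt v ltac:(lra)) as Hb.
  pose proof (sin_asin v ltac:(lra)) as Hs.
  pose proof (sin_ge_half_id (/ 3) ltac:(lra)) as H3.
  split.
  - destruct (Rlt_le_dec (- / 3) (asin v)) as [|Hle]; [assumption|].
    pose proof (sin_incr_1 (asin v) (- / 3) ltac:(lra) ltac:(lra) ltac:(lra) ltac:(lra) Hle).
    rewrite sin_neg in *. lra.
  - destruct (Rlt_le_dec (asin v) (/ 3)) as [|Hle]; [assumption|].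
    pose proof (sin_incr_1 (/ 3) (asin v) ltac:(lra) ltac:(lra) ltac:(lra) ltac:(lra) Hle).
    lra.
Qed.

(** The stretching factor of the source: with [X = stretch y * x] the cubic and
    the linear terms of [X^3 + X sin y] are in the ratio that they have in
    [x^3 cos y + x (1 - 3y) sin y]. *)
Definition stretch (y : R) : R := sqrt (cos y * / (1 + -3 * y)).

Lemma stretch_sqr_pos (y : R) :
  interval (/ 3) y -> 0 < cos y * / (1 + -3 * y).
Proof.
  unfold interval. intros Hy. apply Rmult_lt_0_compat.
  - pose proof (cos_ge_half y). unfold interval in H. lra.
  - apply Rinv_0_lt_compat. lra.
Qed.

Lemma stretch_pos (y : R) : interval (/ 3) y -> 0 < stretch y.
Proof. intros Hy. apply sqrt_lt_R0, stretch_sqr_pos, Hy. Qed.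

Lemma stretch_sqr (y : R) :
  interval (/ 3) y -> stretch y * stretch y * (1 + -3 * y) = cos y.
Proof.
  intros Hy. unfold stretch.
  rewrite sqrt_sqrt by (apply Rlt_le, stretch_sqr_pos, Hy).
  unfold interval in Hy. field. lra.
Qed.

Lemma smooth_on_Rinv_affine :
  smooth_on (V := R_NormedModule) (W := R_NormedModule)
    (interval (/ 3)) (fun y => / (1 + -3 * y)).
Proof.
  intros n.
  apply (Ck_on_comp n _ (fun x => x <> 0) (fun y => 1 + -3 * y) Rinv).
  - unfold interval. intros y Hy. lra.
  - prove_Ck_on.
  - apply smooth_on_Rinv. tauto.
Qed.

Lemma smooth_on_stretch :
  smooth_on (V := R_NormedModule) (W := R_NormedModule)
    (interval (/ 3)) stretch.
Proof.
  intros n.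
  apply (Ck_on_comp n _ (fun x => 0 < x) (fun y => cos y * / (1 + -3 * y)) sqrt).
  - apply stretch_sqr_pos.
  - apply Ck_on_mult; [apply Ck_on_sin_cos|apply smooth_on_Rinv_affine].
  - apply smooth_on_sqrt.
Qed.

(** * The functions in real coordinates *)

Lemma cusp_Psi_coords (x y t : R) :
  cusp_Psi x y t =
  ((x ^ 3 * cos y + (x - 3 * x * y) * sin y) * cos t,
   sin y * cos t + cos y * sin t).
Proof. apply injective_projections; simpl; ring. Qed.

Lemma cusp_psi_coords (x y : R) :
  cusp_psi x y = (x ^ 3 * cos y + (x - 3 * x * y) * sin y, sin y).
Proof. apply injective_projections; simpl; ring. Qed.

Lemma cusp_Psi_time_0 (x y : R) : cusp_Psi x y 0 = cusp_psi x y.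
Proof.
  rewrite cusp_Psi_coords, cusp_psi_coords, sin_0, cos_0.
  f_equal; ring.
Qed.

Lemma smooth_cusp_psi : smooth (plane_map cusp_psi).
Proof.
  intros n.
  replace (plane_map cusp_psi) with (fun p : R * R =>
    ((fst p * (fst p * fst p)) * cos (snd p)
       + (fst p + -3 * (fst p * snd p)) * sin (snd p),
     sin (snd p))).
  - apply (Ck_on_pair (W1 := R_NormedModule) (W2 := R_NormedModule));
    prove_Ck_on.
  - apply functional_extensionality. intros [x y].
    unfold plane_map. rewrite cusp_psi_coords; simpl. f_equal. ring.
Qed.

Lemma smooth_cusp_Psi : smooth (spacetime_map cusp_Psi).
Proof.
  intros n.
  replace (spacetime_map cusp_Psi) with (fun p : R * R * R =>
    (((fst (fst p) * (fst (fst p) * fst (fst p))) * cos (snd (fst p))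
       + (fst (fst p) + -3 * (fst (fst p) * snd (fst p))) * sin (snd (fst p)))
      * cos (snd p),
     sin (snd (fst p)) * cos (snd p) + cos (snd (fst p)) * sin (snd p))).
  - apply (Ck_on_pair (W1 := R_NormedModule) (W2 := R_NormedModule));
    prove_Ck_on.
  - apply functional_extensionality. intros [[x y] t].
    unfold spacetime_map. rewrite cusp_Psi_coords; simpl. f_equal. ring.
Qed.

(** The first map takes [sin y] as a coordinate and rescales [x], the
    second multiplies the real part by [stretch y / (1 - 3y)], expressed through
    the imaginary part [sin y]; [stretch_sqr] makes the two sides agree. *)
Lemma whitney_cusp_cusp_psi : whitney_cusp cusp_psi 0 0.
Proof.
  split; [|split].
  - exists (fun _ => True). split; [apply open_true|split; [exact I|]].
    exact smooth_cusp_psi.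
  - rewrite cusp_psi_coords, sin_0. apply injective_projections; simpl; ring.
  - exists (fun p : R * R => (fst p * stretch (snd p), sin (snd p))).
    exists (fun w : C => (fst w * (stretch (asin (snd w))
                                   * / (1 + -3 * asin (snd w))), snd w)).
    pose proof PI2_3_2 as HPI.
    assert (Hasin : smooth_on (V := R_NormedModule) (W := R_NormedModule)
                      (interval (/ 6)) asin).
    { intros n. apply (Ck_on_comp n _ (fun x => -1 < x < 1) (fun x => x) asin).
      - unfold interval. intros x Hx. lra.
      - prove_Ck_on.
      - apply smooth_on_asin. }
    split; [|split].
    + apply (local_diffeo_fibred (interval (/ 3)) (interval (/ 6))
               stretch sin asin);
        try apply open_interval; try (unfold interval; lra); auto.
      * apply smooth_on_stretch.
      * intros y Hy. apply Rgt_not_eq, stretch_pos, Hy.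
      * intros n. apply Ck_on_sin_cos.
      * apply asin_interval.
      * unfold interval. intros y Hy. apply asin_sin. lra.
      * unfold interval. intros z Hz. apply sin_asin. lra.
      * apply sin_0.
    + apply (local_diffeo_fibred (interval (/ 6)) (interval (/ 6))
               (fun v => stretch (asin v) * / (1 + -3 * asin v))
               (fun v => v) (fun v => v));
        try apply open_interval; try (unfold interval; lra); auto.
      * intros n.
        apply (Ck_on_comp n _ (interval (/ 3)) asin
                 (fun y => stretch y * / (1 + -3 * y)) asin_interval (Hasin n)).
        apply Ck_on_mult; [apply smooth_on_stretch|apply smooth_on_Rinv_affine].
      * intros v Hv. apply asin_interval in Hv.
        pose proof (stretch_pos _ Hv). unfold interval in Hv.
        apply Rgt_not_eq, Rmult_lt_0_compat; [lra|].
        apply Rinv_0_lt_compat. lra.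
      * intros n. prove_Ck_on.
      * intros n. prove_Ck_on.
    + refine (locally_snd (interval (/ 3)) _ (open_interval (/ 3)) _ _);
        [unfold interval; lra|].
      intros x y Hy. unfold plane_map. cbn [fst snd].
      rewrite cusp_psi_coords. cbn [fst snd].
      assert (Has : asin (sin y) = y)
        by (unfold interval in Hy; apply asin_sin; lra).
      rewrite Has. pose proof (stretch_sqr y Hy) as Hsq.
      unfold interval in Hy.
      apply injective_projections; simpl; [|ring].
      rewrite <- Hsq. field. lra.
Qed.

(** * The Helmholtz and wave equations *)

Lemma CDerive2_eq (f : R -> C) (a b a1 b1 : R -> R) (s a2 b2 : R) :
  (forall u, f u = (a u, b u)) ->
  (forall u, is_derive a u (a1 u)) -> (forall u, is_derive b u (b1 u)) ->
  is_derive a1 s a2 -> is_derive b1 s b2 ->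
  CDerive2 f s = (a2, b2).
Proof.
  intros Hf Ha Hb Ha1 Hb1.
  apply functional_extensionality in Hf; subst f.
  unfold CDerive2, CDerive; simpl. f_equal.
  - rewrite <- (is_derive_unique _ _ _ Ha1). apply Derive_ext.
    intros u. apply is_derive_unique, Ha.
  - rewrite <- (is_derive_unique _ _ _ Hb1). apply Derive_ext.
    intros u. apply is_derive_unique, Hb.
Qed.

Lemma laplacian_cusp_Psi (x y t : R) :
  laplacian (fun u v => cusp_Psi u v t) x y = Copp (cusp_Psi x y t).
Proof.
  unfold laplacian.
  rewrite (CDerive2_eq (fun u => cusp_Psi u y t) _ _
             (fun u => (3 * u ^ 2 * cos y + (1 - 3 * y) * sin y) * cos t)
             (fun _ => 0) x (6 * x * cos y * cos t) 0
             (fun u => cusp_Psi_coords u y t));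
    try (intros; auto_derive; [exact I|simpl; ring]).
  rewrite (CDerive2_eq (fun v => cusp_Psi x v t) _ _
             (fun v => (- x ^ 3 * sin v - 3 * x * sin v
                        + (x - 3 * x * v) * cos v) * cos t)
             (fun v => cos v * cos t - sin v * sin t) y
             ((- x ^ 3 * cos y - 6 * x * cos y
               - (x - 3 * x * y) * sin y) * cos t)
             (- sin y * cos t - cos y * sin t)
             (fun v => cusp_Psi_coords x v t));
    try (intros; auto_derive; [exact I|simpl; ring]).
  rewrite cusp_Psi_coords. apply injective_projections; simpl; ring.
Qed.

Lemma CDerive2_cusp_Psi_time (x y t : R) :
  CDerive2 (fun u => cusp_Psi x y u) t = Copp (cusp_Psi x y t).
Proof.
  rewrite (CDerive2_eq (fun u => cusp_Psi x y u) _ _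
             (fun u => - (x ^ 3 * cos y + (x - 3 * x * y) * sin y) * sin u)
             (fun u => - sin y * sin u + cos y * cos u) t
             (- (x ^ 3 * cos y + (x - 3 * x * y) * sin y) * cos t)
             (- sin y * cos t - cos y * sin t)
             (fun u => cusp_Psi_coords x y u));
    try (intros; auto_derive; [exact I|simpl; ring]).
  rewrite cusp_Psi_coords. apply injective_projections; simpl; ring.
Qed.

Lemma helmholtz_equation_cusp_Psi (t : R) :
  helmholtz_equation 1 (fun x y => cusp_Psi x y t).
Proof.
  intros x y. rewrite laplacian_cusp_Psi.
  apply injective_projections; simpl; ring.
Qed.

Lemma helmholtz_wave_cusp_Psi : helmholtz_wave 1 1 cusp_Psi.
Proof.
  split; [lra|split; [lra|split; [exact smooth_cusp_Psi|split]]].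
  - exact helmholtz_equation_cusp_Psi.
  - intros x y t. rewrite laplacian_cusp_Psi, CDerive2_cusp_Psi_time.
    apply injective_projections; simpl; ring.
Qed.

(** * The bifurcation of the zeros *)

Lemma sin_eq_0_small (z : R) : interval 1 z -> sin z = 0 -> z = 0.
Proof.
  unfold interval. intros Hz Hs.
  rewrite <- (asin_sin z), Hs; [apply asin_0|].
  pose proof PI2_3_2. lra.
Qed.

(** The imaginary part is [sin (y + t)], so a zero has [y = - t]; there the real
    part is [(x^3 cos t - x (1 + 3t) sin t) cos t], and [cos t > 0]. *)
Lemma cusp_Psi_eq_0 (x y t : R) :
  interval (/ 2) y -> interval (/ 2) t ->
  cusp_Psi x y t = RtoC 0 <->
  y = - t /\ x * (x ^ 2 - (1 + 3 * t) * tan t) = 0.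
Proof.
  intros Hy Ht. rewrite cusp_Psi_coords.
  assert (Hc : 0 < cos t).
  { pose proof (cos_ge_half t). unfold interval in *. lra. }
  assert (Htan : tan t * cos t = sin t) by (unfold tan; field; lra).
  assert (Hx : (x ^ 3 * cos t - (x + 3 * x * t) * sin t) * cos t
               = x * (x ^ 2 - (1 + 3 * t) * tan t) * (cos t * cos t)).
  { rewrite <- Htan. ring. }
  split.
  - intros H. injection H as Hre Him.
    rewrite <- sin_plus in Him. apply sin_eq_0_small in Him;
      [|unfold interval in *; lra].
    assert (y = - t) by lra. subst y. split; [reflexivity|].
    rewrite sin_neg, cos_neg in Hre.
    apply (Rmult_eq_reg_r (cos t * cos t)); [|nra].
    rewrite <- Hx. rewrite Rmult_0_l, <- Hre. ring.
  - intros [-> H]. rewrite H in Hx. unfold RtoC.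
    rewrite sin_neg, cos_neg. f_equal; [|ring].
    rewrite Rmult_0_l in Hx. rewrite <- Hx. ring.
Qed.

Lemma ball_plane (x y r : R) :
  ball ((0, 0) : R * R) r (x, y) <-> interval r x /\ interval r y.
Proof.
  change (Rabs (x - 0) < r /\ Rabs (y - 0) < r <-> interval r x /\ interval r y).
  unfold interval. rewrite !Rminus_0_r. split.
  - intros [Hx Hy]. apply Rabs_def2 in Hx, Hy. lra.
  - intros [Hx Hy]. split; apply Rabs_def1; lra.
Qed.

(** For [- 1/4 < t <= 0] the number [(1 + 3t) tan t] is nonpositive, so that
    only the root [x = 0] is left. *)
Lemma one_zero (r t : R) :
  0 < r < / 4 -> - r < t <= 0 ->
  number_of_zeros_in (ball (0, 0) r) (fun x y => cusp_Psi x y t) 1.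
Proof.
  intros Hr Ht. exists ((0, - t) :: nil).
  split; [repeat constructor; simpl; tauto|split; [reflexivity|]].
  assert (Htan : tan t <= 0).
  { destruct (Req_dec t 0) as [->|]; [rewrite tan_0; lra|].
    apply Rlt_le, tan_lt_0; pose proof PI2_3_2; lra. }
  intros [x y]. rewrite ball_plane. simpl In; simpl fst; simpl snd. split.
  - intros [H|[]]. injection H as <- <-. unfold interval.
    split; [lra|]. apply cusp_Psi_eq_0; unfold interval; lra.
  - intros [[Hx Hy] H]. left. unfold interval in *.
    apply cusp_Psi_eq_0 in H; unfold interval; try lra.
    destruct H as [-> H]. f_equal.
    apply Rmult_integral in H. destruct H as [H|H]; [auto|].
    (* The two terms of x^2 - (1 + 3t) tan t are nonnegative. *)
    assert (x ^ 2 = 0) as H2.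
    { assert (0 <= x ^ 2) by apply pow2_ge_0. nra. }
    symmetry. exact (Rsqr_0_uniq x (eq_trans (Rsqr_pow2 x) H2)).
Qed.

Lemma tan_le_double (t : R) : 0 <= t < 1 -> 0 <= tan t <= 2 * t.
Proof.
  intros Ht. pose proof (cos_ge_half t) as Hc. unfold interval in Hc.
  assert (Htan : tan t * cos t = sin t) by (unfold tan; field; lra).
  assert (0 <= sin t) by (pose proof (sin_ge_half_id t Ht); lra).
  assert (sin t <= t).
  { destruct (Req_dec t 0) as [->|]; [rewrite sin_0; lra|].
    apply Rlt_le, sin_lt_x. lra. }
  split; nra.
Qed.

(** The bound on [t] keeps the outer zeros in the ball: their squared abscissa
    is [(1 + 3t) tan t <= 2 * 2t < r^2]. *)
Lemma three_zeros (r t : R) :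
  0 < r < / 4 -> 0 < t < r ^ 2 / 4 ->
  number_of_zeros_in (ball (0, 0) r) (fun x y => cusp_Psi x y t) 3.
Proof.
  intros Hr Ht.
  assert (Htr : t < r) by nra.
  assert (Htan : 0 < tan t) by (apply tan_gt_0; pose proof PI2_3_2; lra).
  pose proof (tan_le_double t ltac:(lra)) as Htan2.
  set (q := (1 + 3 * t) * tan t).
  assert (Hq : 0 < q < r ^ 2) by (unfold q; split; nra).
  set (d := sqrt q).
  assert (Hd0 : 0 < d) by (apply sqrt_lt_R0; lra).
  assert (Hd2 : d * d = q) by (apply sqrt_sqrt; lra).
  assert (Hdr : d < r) by nra.
  exists ((0, - t) :: (d, - t) :: (- d, - t) :: nil).
  split; [|split; [reflexivity|]].
  - assert (Hne : forall a b : R, a <> b -> (a, - t) <> (b, - t)).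
    { intros a b Hab H. injection H as H. auto. }
    repeat constructor; simpl; intros H;
      repeat destruct H as [H|H]; try exact H;
      revert H; apply Hne; lra.
  - intros [x y]. rewrite ball_plane. simpl fst; simpl snd. split.
    + intros H.
      assert (y = - t /\ (x = 0 \/ x = d \/ x = - d)) as [-> Hx].
      { simpl in H. repeat destruct H as [H|H]; try easy;
        injection H as <- <-; auto. }
      split; [unfold interval; destruct Hx as [->|[->| ->]]; lra|].
      apply cusp_Psi_eq_0; try (unfold interval; lra).
      split; [reflexivity|]. fold q. rewrite <- Hd2.
      destruct Hx as [->|[->| ->]]; ring.
    + intros [[Hx Hy] H]. unfold interval in *.
      apply cusp_Psi_eq_0 in H; try (unfold interval; lra).
      destruct H as [-> H]. fold q in H. rewrite <- Hd2 in H.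
      replace (x * (x ^ 2 - d * d)) with (x * ((x - d) * (x + d))) in H by ring.
      apply Rmult_integral in H. destruct H as [->|H]; [left; reflexivity|].
      apply Rmult_integral in H. right. destruct H as [H|H].
      * left. f_equal. lra.
      * right. left. f_equal. lra.
Qed.

(** Both components of psi have vanishing [x]-derivative at the origin: on the
    axis [y = 0] the function is [x^3]. *)
Lemma degenerate_zero_cusp_Psi : degenerate_zero (fun x y => cusp_Psi x y 0) 0 0.
Proof.
  split.
  - apply cusp_Psi_eq_0; unfold interval; lra.
  - unfold jacobian. cbv beta.
    assert (Hre : Derive (fun u => Re (cusp_Psi u 0 0)) 0 = 0).
    { apply is_derive_unique, (is_derive_ext (fun u => u ^ 3)).
      - intros u. rewrite cusp_Psi_coords, sin_0, cos_0. simpl. ring.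
      - auto_derive; [exact I|ring]. }
    assert (Him : Derive (fun u => Im (cusp_Psi u 0 0)) 0 = 0).
    { apply is_derive_unique, (is_derive_ext (fun _ => 0)).
      - intros u. rewrite cusp_Psi_coords, sin_0, cos_0. simpl. ring.
      - auto_derive; [exact I|ring]. }
    rewrite Hre, Him. ring.
Qed.

Lemma three_point_bifurcation_cusp_Psi : three_point_bifurcation cusp_Psi 0 0 0.
Proof.
  split; [exact degenerate_zero_cusp_Psi|].
  exists 1. split; [left; reflexivity|].
  exists (/ 4). split; [lra|]. intros r Hr.
  split; [apply one_zero; lra|].
  exists (r ^ 2 / 4). split; [nra|]. intros tau Htau. split.
  - apply one_zero; [exact Hr|]. nra.
  - apply three_zeros; [exact Hr|]. nra.
Qed.

Theorem proposition3p5 :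
  (exists (k c : R) (F : R -> R -> R -> C) (x0 y0 t0 : R),
     helmholtz_wave k c F /\ whitney_cusp (fun x y => F x y t0) x0 y0) /\
  (whitney_cusp cusp_psi 0 0 /\
   smooth (plane_map cusp_psi) /\
   helmholtz_equation 1 cusp_psi) /\
  (helmholtz_wave 1 1 cusp_Psi /\
   (forall x y : R, cusp_Psi x y 0 = cusp_psi x y) /\
   three_point_bifurcation cusp_Psi 0 0 0).
Proof.
  assert (Hslice : (fun x y => cusp_Psi x y 0) = cusp_psi).
  { apply functional_extensionality; intros x.
    apply functional_extensionality; intros y. apply cusp_Psi_time_0. }
  split; [|split; [split; [|split]|split; [|split]]].
  - exists 1, 1, cusp_Psi, 0, 0, 0. rewrite Hslice.
    split; [exact helmholtz_wave_cusp_Psi|exact whitney_cusp_cusp_psi].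
  - exact whitney_cusp_cusp_psi.
  - exact smooth_cusp_psi.
  - rewrite <- Hslice. apply helmholtz_equation_cusp_Psi.
  - exact helmholtz_wave_cusp_Psi.
  - exact cusp_Psi_time_0.
  - exact three_point_bifurcation_cusp_Psi.
Qed.
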